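(* There is a universal constant $c>0$ such that the following holds. Suppose a learner with actions $\{1,\dots,M\}$ observes rewards $r_t=\theta_{a_t}+\varepsilon_t$, $t=1,\dots,T$, with $\varepsilon_t\sim\mathcal{N}(0,1)$ i.i.d. and $\theta\in\mathbb{R}^M$ an unknown mean vector. Let $\Delta>0$ and let $\mathcal{P}$ be the family of instances $\theta$ in which exactly one action $j^\star$ has mean $\theta_{j^\star}=\Delta$ and all other actions have mean $0$. If $$T<c\,\frac{M}{\Delta^2},$$ then $$\inf_{\text{alg}}\ \sup_{\theta\in\mathcal{P}}\ \mathbb{P}_\theta(\hat\jmath\ne j^\star)\ge\frac13,$$ where the infimum is over all (possibly adaptive) algorithms that output an estimate $\hat\jmath\in\{1,\dots,M\}$ after $T$ samples. In particular, to identify the best action with probability at least $2/3$, the sample size must scale as $T=\Omega(M/\Delta^2)$.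
   Context: This is the special case $d=1$, $z_t\equiv1$ of the contextual linear reward model $r_t=\langle W^\star_{a_t},z_t\rangle+\varepsilon_t$. At each time $t$ the algorithm selects an action $a_t\in\{1,\dots,M\}$, possibly depending on past actions and rewards (and internal randomness), and then observes $r_t$; after $T$ rounds it outputs $\hat\jmath$. $\mathbb{P}_\theta$ denotes the law of the interaction under mean vector $\theta$.
   Formalization: The number of actions M is assumed to be at least 2; for M = 1 the only possible answer is always correct, so the error probability is 0 and the claimed bound fails (for instance with T = 0). *)

(* Defs.v *)
From HB Require Import structures.
From mathcomp Require Import all_boot all_order all_algebra.
From mathcomp Require Import all_classical all_reals all_analysis.

Set Implicit Arguments.
Unset Strict Implicit.
Unset Printing Implicit Defensive.

Import Order.TTheory GRing.Theory Num.Theory.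
Import numFieldNormedType.Exports.

Local Open Scope classical_set_scope.
Local Open Scope ring_scope.

(* normal_prob is a measure on measurableTypeR R, which is R up to conversion
   but carries another measure_display. *)
Definition tuple_cons (R : realType) (n : nat)
    (x : measurableTypeR R * n.-tuple (measurableTypeR R)) :
    n.+1.-tuple (measurableTypeR R) :=
  [tuple of x.1 :: x.2].

Lemma measurable_tuple_cons (R : realType) (n : nat) :
  measurable_fun [set: measurableTypeR R * n.-tuple (measurableTypeR R)]
    (@tuple_cons R n).
Proof. exact: measurable_cons. Qed.

HB.instance Definition _ (R : realType) (n : nat) :=
  isMeasurableFun.Build _ _ _ _ (@tuple_cons R n) (@measurable_tuple_cons R n).

(* The law of n i.i.d. N(0,1) variables, that is, the n-fold product measure. *)
Fixpoint noise_law (R : realType) (n : nat) :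
    probability (n.-tuple (measurableTypeR R)) R :=
  match n with
  | 0 => \d_([tuple] : 0.-tuple (measurableTypeR R))
  | n'.+1 =>
      distribution (normal_prob 0 1 \x noise_law R n')%E (@tuple_cons R n')
  end.

Section bandit.
Variables (R : realType) (M : nat).

(* Past (action, reward) pairs, in chronological order. *)
Definition history := seq ('I_M * R).

(* A randomised adaptive algorithm: a seed drawn once, independently of the
   noise, in an arbitrary probability space, then a choice of the next action
   given the seed and the history, and an answer given the seed and the final
   history.  As 'I_M is finite, measurability with respect to the history means
   measurability in the rewards once the actions are fixed. *)
Record algorithm := Algorithm {
  seed_display : measure_display ;
  seed : measurableType seed_display ;
  seed_law : probability seed R ;
  act : seed -> history -> 'I_M ;
  answer : seed -> history -> 'I_M ;
  measurable_act : forall n (a : n.-tuple 'I_M),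
    measurable_fun [set: seed * n.-tuple (measurableTypeR R)]
      (fun x => act x.1 (zip a x.2) : nat) ;
  measurable_answer : forall n (a : n.-tuple 'I_M),
    measurable_fun [set: seed * n.-tuple (measurableTypeR R)]
      (fun x => answer x.1 (zip a x.2) : nat) }.

(* The history after h once rounds with noise values e have been played:
   each round picks a and returns the reward theta_a + eps. *)
Fixpoint play (A : algorithm) (theta : 'rV[R]_M) (s : seed A) (h : history)
    (e : seq R) : history :=
  match e with
  | [::] => h
  | eps :: e' =>
      let a := act s h in play theta s (rcons h (a, theta 0 a + eps)) e'
  end.

Section interaction.
Variables (A : algorithm) (T : nat).

Definition run := (seed A * T.-tuple (measurableTypeR R))%type.

Definition run_law : probability run R := (@seed_law A \x noise_law R T)%E.

Definition estimate (theta : 'rV[R]_M) (x : run) : 'I_M :=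
  answer x.1 (play theta x.1 [::] x.2).

End interaction.

Definition instance_at (Delta : R) (j : 'I_M) (theta : 'rV[R]_M) : Prop :=
  theta 0 j = Delta /\ forall i, i != j -> theta 0 i = 0.

Definition error_prob (T : nat) (A : algorithm) (theta : 'rV[R]_M) (j : 'I_M) :
    \bar R :=
  run_law A T [set x : run A T | estimate theta x != j].

Definition success_prob (T : nat) (A : algorithm) (theta : 'rV[R]_M)
    (j : 'I_M) : \bar R :=
  run_law A T [set x : run A T | estimate theta x = j].

Definition worst_error (T : nat) (Delta : R) (A : algorithm) : \bar R :=
  ereal_sup [set p | exists (theta : 'rV[R]_M) (j : 'I_M),
    instance_at Delta j theta /\ p = error_prob T A theta j].

Definition minimax_error (T : nat) (Delta : R) : \bar R :=
  ereal_inf [set p | exists A : algorithm, p = worst_error T Delta A].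

End bandit.

Arguments minimax_error {R} M T Delta.

(* Main.v *)
(* Compare every instance with [theta = 0].  For a function [F] of the final
   history, Jensen's inequality applied round by round to the likelihood ratio
   exp (theta_a y - theta_a^2 / 2) of N(theta_a, 1) with respect to N(0, 1)
   gives
     exp (E_0 F - E_0 cost) <= E_theta (exp F),
   where the cost of a history is the sum of theta_a^2 / 2 over its rounds.  For
   the instance whose best arm is j, take F = 1/5 times the indicator of the
   error event; linearising both exponentials yields
     P_0 (answer <> j) / 5 - Delta^2 / 2 * E_0 N_j <= P_j (answer <> j) / 4,
   N_j being the number of pulls of j.  Summed over j, the left-hand side is
   (M - 1) / 5 - Delta^2 T / 2 whatever the algorithm does, so that the average
   error probability exceeds 1/3 as soon as T < M / (60 Delta^2). *)
Require Import Defs.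
From HB Require Import structures.
From mathcomp Require Import all_boot all_order all_algebra.
From mathcomp Require Import all_classical all_reals all_analysis.
From mathcomp Require Import measurable_realfun ring lra.

Set Implicit Arguments.
Unset Strict Implicit.
Unset Printing Implicit Defensive.

Import Order.TTheory GRing.Theory Num.Theory.
Import numFieldNormedType.Exports.

Local Open Scope classical_set_scope.
Local Open Scope ring_scope.

(* [noise_law] is built on [measurableTypeR R], whose display differs from that
   of [R]. *)
Local Notation gauss R m :=
  (normal_prob m 1 : probability (measurableTypeR R) R).
Local Notation leb R :=
  (@lebesgue_measure R : {measure set (measurableTypeR R) -> \bar R}).

(** * Gaussian integrals: density, translation, moments, Jensen bound *)

Lemma Rintegral_probability_cst d (T : measurableType d) (R : realType)
    (P : probability T R) (c : R) : \int[P]_(_ in [set: T]) c = c.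
Proof.
by rewrite Rintegral_cst// [X in fine X](@probability_setT _ _ _ P) mulr1.
Qed.

(** The Radon-Nikodym derivative and [normal_pdf] have the same integral over every measurable set,
    hence agree almost everywhere. *)
Lemma ge0_integral_normal_prob (R : realType) (m : R)
    (f : measurableTypeR R -> \bar R) :
  (forall x, 0 <= f x)%E -> measurable_fun [set: measurableTypeR R] f ->
  (\int[gauss R m]_x f x =
   \int[leb R]_x (f x * (normal_pdf m 1 x)%:E))%E.
Proof.
move=> f0 mf.
have dom := @normal_prob_dominates R m 1.
rewrite -(Radon_Nikodym_SigmaFinite.change_of_variables dom f0 measurableT mf).
have mpdf : measurable_fun [set: R] (fun x => (normal_pdf m 1 x)%:E).
  by apply/measurable_EFinP; exact: measurable_normal_pdf.
have iRN := Radon_Nikodym_SigmaFinite.f_integrable dom.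
apply: ae_eq_integral => //.
- by apply: emeasurable_funM => //; exact: measurable_int iRN.
- exact: emeasurable_funM.
apply: ae_eqe_mul2l; apply: integral_ae_eq => // E _ mE.
by rewrite -Radon_Nikodym_SigmaFinite.f_integral.
Qed.

(** By uniqueness of Lebesgue measure it suffices to look at half-open intervals, whose preimages
    are intervals of the same length. *)
Lemma lebesgue_measure_pushforward_shift (R : realType) (a : R) A :
  measurable A ->
  pushforward (leb R) (fun x : measurableTypeR R => a + x) A =
  lebesgue_measure A.
Proof.
have mshift : measurable_fun [set: measurableTypeR R]
    (fun x => a + x : measurableTypeR R).
  exact: measurable_funD.
pose mx := isMeasurableFun.Build _ _ _ _ _ mshift.
pose f : {mfun measurableTypeR R >-> measurableTypeR R} :=
  HB.pack (fun x : measurableTypeR R => a + x : measurableTypeR R) mx.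
move=> mA; apply/esym.
apply: (@lebesgue_measure_unique _ (pushforward (leb R) f)) => //.
move=> _ [[b c]] _ <-.
transitivity (lebesgue_measure
    (`]b - a, c - a]%classic : set (measurableTypeR R))); last first.
  congr lebesgue_measure.
  by apply/seteqP; split => x /=; rewrite !in_itv/= ltrBlDl lerBrDl.
rewrite !lebesgue_measure_itv/= !lte_fin ltrD2r; case: ifP => // _.
by rewrite -!EFinB; congr EFin; ring.
Qed.

Lemma normal_pdf1_shift (R : realType) (a x : R) :
  normal_pdf a 1 x = expR (a * x - a ^+ 2 / 2) * normal_pdf 0 1 x.
Proof.
rewrite !normal_pdfE ?oner_neq0// mulrCA; congr (_ * _).
by rewrite /normal_fun -expRD; congr expR; field.
Qed.

(** One-dimensional Cameron-Martin formula: both sides are the integral of [f] against the density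
    of N(a,1), on the left by translation invariance of Lebesgue measure, on the right by completing
    the square. *)
Lemma ge0_integral_normal_prob_shift (R : realType) (a : R)
    (f : measurableTypeR R -> \bar R) :
  (forall x, 0 <= f x)%E -> measurable_fun [set: measurableTypeR R] f ->
  (\int[gauss R 0]_x f (a + x)%R =
   \int[gauss R 0]_x (f x * (expR (a * x - a ^+ 2 / 2))%:E))%E.
Proof.
move=> f0 mf.
have mshift : measurable_fun [set: measurableTypeR R]
    (fun x => a + x : measurableTypeR R).
  exact: measurable_funD.
have mexp : measurable_fun [set: measurableTypeR R]
    (fun x => (expR (a * x - a ^+ 2 / 2))%:E).
  apply/measurable_EFinP/measurableT_comp => //.
  by apply: measurable_funB => //; exact: measurable_funM.
rewrite ge0_integral_normal_prob//; last first.
  exact: (measurableT_comp mf mshift).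
rewrite [RHS]ge0_integral_normal_prob//; first last.
- exact: emeasurable_funM.
- by move=> x; rewrite mule_ge0// lee_fin expR_ge0.
pose g (x : measurableTypeR R) := (f x * (normal_pdf a 1 x)%:E)%E.
have g0 x : (0 <= g x)%E by rewrite mule_ge0// lee_fin normal_pdf_ge0.
have mg : measurable_fun [set: measurableTypeR R] g.
  apply: emeasurable_funM => //; apply/measurable_EFinP.
  exact: measurable_normal_pdf.
transitivity (\int[leb R]_x g (a + x)%R)%E.
  apply: eq_integral => x _; rewrite /g; congr (_ * _%:E)%E.
  by rewrite !normal_pdfE ?oner_neq0// /normal_fun addrAC subrr add0r subr0.
transitivity (\int[leb R]_x g x)%E; last first.
  by apply: eq_integral => x _; rewrite /g normal_pdf1_shift EFinM muleA.
transitivity (\int[pushforward (leb R)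
    (fun x => (a + x)%R : measurableTypeR R)]_x g x)%E.
  by rewrite ge0_integral_pushforward.
apply: eq_measure_integral => A mA _.
exact: lebesgue_measure_pushforward_shift.
Qed.

(** The shift formula at the constant 1 says that [expR (a * x - a ^+ 2 / 2)] has total mass 1. *)
Lemma integral_normal_prob_expR (R : realType) (a : R) :
  (\int[gauss R 0]_(x in [set: measurableTypeR R]) (expR (a * x))%:E =
   (expR (a ^+ 2 / 2))%:E)%E.
Proof.
have mexp : measurable_fun [set: measurableTypeR R]
    (fun x => (expR (a * x - a ^+ 2 / 2))%:E).
  apply/measurable_EFinP/measurableT_comp => //.
  by apply: measurable_funB => //; exact: measurable_funM.
have := @ge0_integral_normal_prob_shift R a (cst 1%E) (fun=> lee01)
  (measurable_cst _).
rewrite integral_cst// [X in (_ * X)%E](@probability_setT _ _ _ (gauss R 0)).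
rewrite mule1 => h.
rewrite -[RHS]mule1 h -ge0_integralZl//.
- apply: eq_integral => x _; rewrite mul1e -EFinM -expRD.
  by congr (expR _)%:E; ring.
- by apply: emeasurable_funM.
- by move=> x _; rewrite mul1e lee_fin expR_ge0.
Qed.

(** Domination: [|x| <= expR x + expR (- x)]. *)
Lemma integrable_normal_prob_id (R : realType) :
  (gauss R 0).-integrable setT (fun x : measurableTypeR R => x%:E).
Proof.
have mexp (a : R) : measurable_fun [set: measurableTypeR R]
    (fun x => (expR (a * x))%:E).
  by apply/measurable_EFinP/measurableT_comp => //; exact: measurable_funM.
have iexp (a : R) : (gauss R 0).-integrable setT
    (fun x : measurableTypeR R => (expR (a * x))%:E).
  apply/integrableP; split => //.
  under eq_integral do rewrite gee0_abs ?lee_fin ?expR_ge0//.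
  by rewrite integral_normal_prob_expR ltry.
apply: (le_integrable _ _ _ (integrableD _ (iexp 1) (iexp (-1)))) => //.
  by apply/measurable_EFinP.
move=> x _ /=; rewrite lee_fin mul1r mulN1r.
have h1 := expR_ge1Dx x; have h2 := expR_ge1Dx (- x).
have p1 := expR_gt0 x; have p2 := expR_gt0 (- x).
rewrite [leRHS]ger0_norm; last by rewrite addr_ge0// ltW.
by rewrite ler_norml; apply/andP; split; lra.
Qed.

(* [t y <= expR (t y) - 1] integrates to [t E(y) <= expR (t^2/2) - 1 <= t^2]
   for both signs of a small [t]. *)
Lemma Rintegral_normal_prob_id (R : realType) :
  \int[gauss R 0]_(x in [set: measurableTypeR R]) x = 0.
Proof.
set I := Rintegral _ _ _.
have iid := @integrable_normal_prob_id R.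
have key (t : R) : `|t| <= 1 -> t * I <= t ^+ 2.
  move=> t1.
  have : t * I <= expR (t ^+ 2 / 2) - 1.
    have iexp : (gauss R 0).-integrable setT
        (EFin \o (fun x : measurableTypeR R => expR (t * x))).
      apply/integrableP; split.
        by apply/measurable_EFinP/measurableT_comp.
      under eq_integral do rewrite /= ger0_norm ?expR_ge0//.
      by rewrite integral_normal_prob_expR ltry.
    have -> : expR (t ^+ 2 / 2) - 1 =
        \int[gauss R 0]_(x in [set: measurableTypeR R]) (expR (t * x) - 1).
      rewrite RintegralB//; last exact: finite_measure_integrable_cst.
      rewrite Rintegral_probability_cst; congr (_ - _).
      by rewrite /Rintegral integral_normal_prob_expR.
    rewrite /I -RintegralZl//; apply: le_Rintegral => //.
    - exact: (integrableZl measurableT t iid).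
    - exact: (integrableB measurableT iexp
        (finite_measure_integrable_cst (gauss R 0) 1 measurableT)).
    - by move=> x _; have := expR_ge1Dx (t * x); lra.
  move/le_trans; apply.
  (* With [u = t ^+ 2 / 2 <= 1 / 2], [expR (- u) >= 1 - u] gives
     [expR u <= 1 / (1 - u) <= 1 + 2 * u]. *)
  have t2 : t ^+ 2 <= 1 by rewrite -real_normK ?num_real// expr_le1.
  have := expR_ge1Dx (- (t ^+ 2 / 2)); have := expRxMexpNx_1 (t ^+ 2 / 2).
  have := expR_gt0 (t ^+ 2 / 2); have := sqr_ge0 t.
  by nra.
apply/eqP/negP => /negP I0.
have aI : 0 < `|I| by rewrite normr_gt0.
(* The sign makes [t * I = |t| * |I|], so [key] yields [|I| <= |t| <= |I| / 2], which is absurd for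
   nonzero [I]. *)
pose t := Num.sg I * Num.min 1 (`|I| / 2).
have m0 : 0 < Num.min 1 (`|I| / 2) by rewrite lt_min ltr01 divr_gt0.
have nt : `|t| = Num.min 1 (`|I| / 2).
  by rewrite /t normrM normr_sg I0 mul1r ger0_norm// ltW.
have := key t; rewrite nt ge_min lexx => /(_ isT).
rewrite -[t ^+ 2]real_normK ?num_real// nt /t.
rewrite mulrAC [_ * I]mulrC -[I * _]mulrC -normrEsg.
rewrite expr2 ler_pM2r// le_min => /andP[_]; lra.
Qed.

Lemma finite_measure_integrable_bounded d (T : measurableType d) (R : realType)
    (mu : {finite_measure set T -> \bar R}) (f : T -> R) (B : R) :
  measurable_fun setT f -> (forall x, `|f x| <= B) ->
  mu.-integrable setT (EFin \o f).
Proof.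
move=> mf fB; apply: measurable_bounded_integrable => //.
  exact: fin_num_fun_lty.
exists B; split; first exact: num_real.
by move=> C BC x _ /=; exact: le_trans (fB x) (ltW BC).
Qed.

(* Jensen's inequality for the density [expR (a y - a^2/2)] of N(a,1) with
   respect to N(0,1), by the tangent line of [expR] at the mean. *)
Lemma normal_prob_shift_jensen (R : realType) (a B : R)
    (v : measurableTypeR R -> R) :
  measurable_fun [set: measurableTypeR R] v -> (forall x, `|v x| <= B) ->
  ((expR (\int[gauss R 0]_x v x - a ^+ 2 / 2))%:E <=
   \int[gauss R 0]_x (expR (v (a + x)))%:E)%E.
Proof.
move=> mv vB.
have mev : measurable_fun [set: measurableTypeR R] (fun x => (expR (v x))%:E).
  by apply/measurable_EFinP/measurableT_comp.
rewrite (@ge0_integral_normal_prob_shift _ a (fun x => (expR (v x))%:E))//.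
set m := Rintegral _ _ _ - _.
have iv : (gauss R 0).-integrable setT (EFin \o v).
  exact: finite_measure_integrable_bounded vB.
have iid := @integrable_normal_prob_id R.
pose w (x : measurableTypeR R) := v x + a * x.
have iw : (gauss R 0).-integrable setT (EFin \o w).
  exact: (integrableD measurableT iv (integrableZl measurableT a iid)).
have ic (c : R) : (gauss R 0).-integrable setT
    (EFin \o @cst (measurableTypeR R) R c).
  exact: finite_measure_integrable_cst.
have iwc : (gauss R 0).-integrable setT
    (EFin \o (fun x => w x + (1 - a ^+ 2 / 2 - m))).
  exact: (integrableD measurableT iw (ic _)).
(* The integrand is the tangent at [m], taken at [v x + a * x - a ^+ 2 / 2]; this exponent has mean
   [m] because N(0,1) is centred. *)
have -> : expR m = \int[gauss R 0]_x (expR m * (w x + (1 - a ^+ 2 / 2 - m))).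
  rewrite RintegralZl// RintegralD//; last exact: ic.
  rewrite Rintegral_probability_cst.
  rewrite RintegralD//; last exact: (integrableZl measurableT a iid).
  rewrite RintegralZl// Rintegral_normal_prob_id mulr0 addr0.
  by rewrite -[LHS]mulr1; congr (_ * _); rewrite /m; ring.
rewrite /Rintegral fineK; last first.
  exact: integrable_fin_num (integrableZl measurableT (expR m) iwc).
set f := fun x : measurableTypeR R => (_ * (expR (a * x - _))%:E)%E.
have f0 x : (0 <= f x)%E by rewrite mule_ge0// lee_fin expR_ge0.
(* An infinite right-hand side is trivial; a finite one makes [f] integrable, so that a pointwise
   comparison suffices. *)
have [->|foo] := eqVneq (\int[gauss R 0]_x f x)%E +oo%E; first exact: leey.
have mf : measurable_fun [set: measurableTypeR R] f.
  apply: emeasurable_funM => //; apply/measurable_EFinP/measurableT_comp => //.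
  by apply: measurable_funB => //; exact: measurable_funM.
apply: le_integral => //.
- exact: (integrableZl measurableT (expR m) iwc).
- apply/integrableP; split => //.
  by under eq_integral do rewrite gee0_abs//; rewrite ltey.
- move=> x _; rewrite /f -EFinM lee_fin.
  rewrite /w -expRD.
  have -> : v x + (a * x - a ^+ 2 / 2) =
      m + (v x + a * x - a ^+ 2 / 2 - m) by ring.
  rewrite [leRHS]expRD ler_pM2l ?expR_gt0//.
  by apply: le_trans (expR_ge1Dx _); lra.
Qed.

(** * Measurability of the interaction *)

Lemma measurable_fun_fin_choice d d' (X : measurableType d)
    (Y : measurableType d') (I : finType) (i : X -> I) (g : I -> X -> Y) :
  (forall k, measurable (i @^-1` [set k])) ->
  (forall k, measurable_fun setT (g k)) ->
  measurable_fun setT (fun x => g (i x) x).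
Proof.
move=> mi mg _ B mB; rewrite setTI.
rewrite (_ : _ @^-1` _ =
    \bigcup_(k in [set: I]) (i @^-1` [set k] `&` g k @^-1` B)).
  apply: fin_bigcup_measurable => // k _; apply: measurableI => //.
  by rewrite -[X in measurable X]setTI; exact: mg.
by apply/seteqP; split => [x gx|x [k _ [/= <-]]//]; exists (i x).
Qed.

Lemma measurable_rcons d d' (X : measurableType d) (Y : measurableType d') n
    (f : X -> n.-tuple Y) (g : X -> Y) :
  measurable_fun setT f -> measurable_fun setT g ->
  measurable_fun setT (fun x => [tuple of rcons (f x) (g x)]).
Proof.
move=> mf mg; apply/measurable_fun_tnthP => i.
have [iltn|nlei] := ltnP i n.
- rewrite (_ : _ \o _ = fun x => tnth (f x) (Ordinal iltn)).
    by move/measurable_fun_tnthP : mf; exact.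
  apply/funext => x /=; rewrite !(tnth_nth (g x)) nth_rcons size_tuple.
  by rewrite iltn.
- rewrite (_ : _ \o _ = g)//; apply/funext => x /=.
  rewrite (tnth_nth (g x)) nth_rcons size_tuple.
  by rewrite ltnNge nlei/=; case: ifP.
Qed.

Section measurable_play.
Variables (R : realType) (M : nat).

(* As for the fields of [algorithm]: measurability in the seed and the rewards
   once the actions are fixed. *)
Definition history_measurable {d} {S : measurableType d} {d'}
    {Y : measurableType d'} (F : S -> history R M -> Y) :=
  forall n (a : n.-tuple 'I_M),
    measurable_fun [set: S * n.-tuple (measurableTypeR R)]
      (fun x => F x.1 (zip a x.2)).

(** The actions depend on the rewards, whereas [history_measurable] fixes them. The induction on the
    remaining rounds therefore splits on the next action [b]: on each of these finitely many
    measurable pieces the past actions are the fixed tuple [rcons a b]. *)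
Lemma measurable_play (A : algorithm R M) (theta : 'rV[R]_M) d'
    (Y : measurableType d') (F : seed A -> history R M -> Y) :
  history_measurable F ->
  forall m n (a : n.-tuple 'I_M),
    measurable_fun
      [set: (seed A * n.-tuple (measurableTypeR R)) *
            m.-tuple (measurableTypeR R)]
      (fun x => F x.1.1 (play theta x.1.1 (zip a x.1.2) x.2)).
Proof.
move=> mF; elim=> [n a|m IHm n a].
  pose g (x : seed A * n.-tuple (measurableTypeR R)) := F x.1 (zip a x.2).
  apply: (eq_measurable_fun (g \o fst)).
    by move=> [[s x] e] _ /=; rewrite [e]tuple0.
  exact: (measurableT_comp (mF n a) measurable_fst).
pose g b (x : (seed A * n.-tuple (measurableTypeR R)) *
    m.+1.-tuple (measurableTypeR R)) :=
  F x.1.1 (play theta x.1.1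
    (zip [tuple of rcons a b] [tuple of rcons x.1.2 (theta 0 b + thead x.2)])
    [tuple of behead x.2]).
pose i (x : (seed A * n.-tuple (measurableTypeR R)) *
    m.+1.-tuple (measurableTypeR R)) := act x.1.1 (zip a x.1.2).
apply: (eq_measurable_fun (fun x => g (i x) x)).
  move=> [[s x] e] _; rewrite /g /i/=.
  by case/tupleP: e => eps e /=; rewrite theadE zip_rcons ?size_tuple.
apply: measurable_fun_fin_choice => b.
  have mi : measurable_fun setT (fun x => i x : nat).
    exact: (measurableT_comp (@measurable_act _ _ A n a)).
  have := mi measurableT [set (b : nat)] => /(_ Logic.I).
  rewrite setTI; congr measurable; apply/seteqP; split => x /=.
    exact: val_inj.
  by move=> ->.
pose h (x : (seed A * n.-tuple (measurableTypeR R)) *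
    m.+1.-tuple (measurableTypeR R)) :=
  ((x.1.1, [tuple of rcons x.1.2 (theta 0 b + thead x.2 : measurableTypeR R)]),
   [tuple of behead x.2]).
have mh : measurable_fun setT h.
  apply/measurable_fun_pairP; split; last first.
    exact: (measurableT_comp (@measurable_behead _ _ _)).
  apply/measurable_fun_pairP; split => /=.
    exact: (measurableT_comp measurable_fst measurable_fst).
  apply: measurable_rcons.
    exact: (measurableT_comp measurable_snd measurable_fst).
  apply: measurable_funD => //.
  exact: (measurableT_comp (@measurable_tnth _ _ _ ord0)).
exact: (measurableT_comp (IHm _ [tuple of rcons a b]) mh).
Qed.

Lemma size_play (A : algorithm R M) (theta : 'rV[R]_M) s (h : history R M) e :
  size (@play R M A theta s h e) = (size h + size e)%N.
Proof.
by elim: e h => [|eps e IHe] h /=; rewrite ?addn0// IHe size_rcons addnS.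
Qed.

End measurable_play.

(** * Integration against the noise law, one round at a time *)

Lemma normr_Rintegral_le d (T : measurableType d) (R : realType)
    (P : probability T R) (f : T -> R) (B : R) :
  measurable_fun setT f -> (forall x, `|f x| <= B) ->
  `|\int[P]_x f x| <= B.
Proof.
move=> mf fB; have if_ := finite_measure_integrable_bounded P mf fB.
apply: le_trans (le_normr_Rintegral _ if_) _ => //.
rewrite -[leRHS](Rintegral_probability_cst P); apply: le_Rintegral => //.
- exact: integrable_norm.
- exact: finite_measure_integrable_cst.
Qed.

Section noise.
Variable R : realType.

Lemma measurable_Rintegral_section d1 d2 (T1 : measurableType d1)
    (T2 : measurableType d2) (P1 : probability T1 R) (P2 : probability T2 R)
    (f : T1 * T2 -> R) (B : R) :
  measurable_fun setT f -> (forall x, `|f x| <= B) ->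
  measurable_fun setT (fun x => \int[P2]_y f (x, y)).
Proof.
move=> mf fB; apply: measurableT_comp => //.
pose P12 : probability (T1 * T2)%type R := (P1 \x P2)%E.
exact: measurable_fubini_F (finite_measure_integrable_bounded P12 mf fB).
Qed.

(** The empty tuple is the only 0-tuple, so any [f] is constant and hence measurable. *)
Lemma integral_noise_law0 (f : 0.-tuple (measurableTypeR R) -> \bar R) :
  (\int[noise_law R 0]_e f e = f [tuple])%E.
Proof.
rewrite integral_dirac//.
  by rewrite [X in (X * _)%E](diracT _ [tuple]) mul1e.
apply: (eq_measurable_fun (cst (f [tuple]))) => // e _.
by rewrite [e]tuple0.
Qed.

Lemma ge0_integral_noise_lawS n
    (f : n.+1.-tuple (measurableTypeR R) -> \bar R) :
  measurable_fun setT f -> (forall e, 0 <= f e)%E ->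
  (\int[noise_law R n.+1]_e f e =
   \int[gauss R 0]_x \int[noise_law R n]_e f (tuple_cons (x, e)))%E.
Proof.
move=> mf f0; rewrite ge0_integral_distribution//= fubini_tonelli1//.
exact: (measurableT_comp mf (@measurable_tuple_cons R n)).
Qed.

Lemma Rintegral_noise_lawS n
    (f : n.+1.-tuple (measurableTypeR R) -> R) (B : R) :
  measurable_fun setT f -> (forall e, `|f e| <= B) ->
  \int[noise_law R n.+1]_e f e =
  \int[gauss R 0]_x \int[noise_law R n]_e f (tuple_cons (x, e)).
Proof.
move=> mf fB.
have mfc := measurableT_comp mf (@measurable_tuple_cons R n).
pose P :
    probability (measurableTypeR R * n.-tuple (measurableTypeR R))%type R :=
  (gauss R 0 \x noise_law R n)%E.
have ifc := finite_measure_integrable_bounded P mfc (fun=> fB _).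
rewrite /Rintegral /=; congr fine.
rewrite integral_distribution//; last exact/measurable_EFinP.
rewrite -integral12_prod_meas1//; apply: eq_integral => x _.
rewrite /fubini_F fineK//; apply: integrable_fin_num => //.
apply: (@finite_measure_integrable_bounded _ _ _ (noise_law R n)
  (fun e => f (tuple_cons (x, e))) B) => //.
exact: (measurableT_comp mfc (pair1_measurable x)).
Qed.

End noise.

(** * Change of measure along the interaction *)

Section cost.
Variables (R : realType) (M : nat) (theta : 'rV[R]_M).

(* The Kullback-Leibler divergence between the reward laws under [0] and under
   [theta], summed over the actions of a history. *)
Definition history_cost (h : history R M) : R :=
  \sum_(r <- h) theta 0 r.1 ^+ 2 / 2.

Lemma history_cost_rcons h a y :
  history_cost (rcons h (a, y)) = history_cost h + theta 0 a ^+ 2 / 2.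
Proof. by rewrite /history_cost big_rcons/= addrC. Qed.

(** Charging every arm in every round is crude, but gives a bound depending on the length of the
    history only, from which integrability follows. *)
Lemma history_cost_bound h :
  `|history_cost h| <= (size h)%:R * \sum_i theta 0 i ^+ 2 / 2.
Proof.
have c0 i : 0 <= theta 0 i ^+ 2 / 2 by rewrite divr_ge0// sqr_ge0.
rewrite ger0_norm; last exact: sumr_ge0.
rewrite /history_cost; elim: h => [|[a y] h IHh].
  by rewrite big_nil mul0r.
rewrite big_cons/= -[(size h).+1%:R]natr1 mulrDl mul1r addrC lerD//.
by rewrite (bigD1 a)//= lerDl sumr_ge0.
Qed.

Lemma measurable_history_cost d (S : measurableType d) :
  history_measurable (fun (_ : S) h => history_cost h).
Proof.
move=> n a.
apply: (eq_measurable_fun (cst (\sum_(b <- a) theta 0 b ^+ 2 / 2))) => //.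
move=> [s x] _ /=; rewrite /history_cost.
by rewrite -[in LHS](@unzip1_zip _ _ a x) ?size_tuple// big_map.
Qed.

End cost.

Section change_of_measure.
Variables (R : realType) (M : nat) (A : algorithm R M) (theta : 'rV[R]_M).
Variables (F : seed A -> history R M -> R) (B : R).
Hypotheses (mF : history_measurable F) (FB : forall s h, `|F s h| <= B).

Let G s h := F s h - history_cost theta h.

Let mG : history_measurable G.
Proof.
move=> n a; apply: measurable_funB; first exact: mF.
exact: measurable_history_cost.
Qed.

Let GB s h : `|G s h| <= B + (size h)%:R * \sum_i theta 0 i ^+ 2 / 2.
Proof. by rewrite (le_trans (ler_normB _ _))// lerD// history_cost_bound. Qed.

(* Adding back the cost of the rounds already played makes the inequality stable
   under induction on the number [n] of remaining rounds. *)
Lemma change_of_measure n s k (a : k.-tuple 'I_M)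
    (x : k.-tuple (measurableTypeR R)) :
  ((expR (\int[noise_law R n]_e
      (F s (play 0 s (zip a x) e) - history_cost theta (play 0 s (zip a x) e))
      + history_cost theta (zip a x)))%:E <=
   \int[noise_law R n]_e (expR (F s (play theta s (zip a x) e)))%:E)%E.
Proof.
elim: n k a x => [k a x|n IHn k a x].
  by rewrite integral_noise_law0 /Rintegral integral_noise_law0/= subrK.
set b := act s (zip a x).
pose a' := [tuple of rcons a b].
pose x' (y : measurableTypeR R) := [tuple of rcons x y].
have zipE y : zip a' (x' y) = rcons (zip a x) (b, y).
  by rewrite zip_rcons// !size_tuple.
have mx' n' : measurable_fun setT
    (fun z : measurableTypeR R * n'.-tuple (measurableTypeR R) =>
      ((s, x' z.1), z.2)).
  apply: measurable_fun_pair => //; apply: measurable_fun_pair => //.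
  exact: measurable_rcons.
have mplay t d (Y : measurableType d) (H : seed A -> history R M -> Y) n'
    k' (a1 : k'.-tuple 'I_M) (x1 : k'.-tuple (measurableTypeR R)) :
    history_measurable H ->
    measurable_fun setT (fun e : n'.-tuple (measurableTypeR R) =>
      H s (play t s (zip a1 x1) e)).
  move=> mH.
  have mp : measurable_fun setT
      (fun e : n'.-tuple (measurableTypeR R) => ((s, x1), e)).
    exact: pair1_measurable.
  exact: (measurableT_comp (measurable_play t mH a1 (m := n')) mp).
pose g (z : measurableTypeR R * n.-tuple (measurableTypeR R)) :=
  G s (play 0 s (zip a' (x' z.1)) z.2).
pose D := B + (k.+1 + n)%:R * \sum_i theta 0 i ^+ 2 / 2.
have mg : measurable_fun setT g.
  exact: (measurableT_comp (measurable_play 0 mG a' (m := n)) (mx' n)).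
have gD z : `|g z| <= D.
  apply: le_trans (GB _ _) _.
  by rewrite size_play zipE size_rcons size_zip !size_tuple minnn.
pose v y := \int[noise_law R n]_e g (y, e).
have mv : measurable_fun [set: measurableTypeR R] v.
  exact: (measurable_Rintegral_section (gauss R 0) (noise_law R n) mg gD).
have vD y : `|v y| <= D.
  apply: normr_Rintegral_le => //.
  exact: (measurableT_comp mg (pair1_measurable y)).
(* Under the zero instance the first reward is the first noise value itself. *)
have -> : \int[noise_law R n.+1]_e (F s (play 0 s (zip a x) e) -
    history_cost theta (play 0 s (zip a x) e)) = \int[gauss R 0]_y v y.
  rewrite (@Rintegral_noise_lawS _ _ _ D).
  - apply: eq_Rintegral => y _; apply: eq_Rintegral => e _ /=.
    by rewrite mxE add0r /g zipE.
  - exact: (mplay 0 _ _ G n.+1).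
  - move=> e; apply: le_trans (GB _ _) _.
    by rewrite size_play size_zip !size_tuple minnn -addSnnS.
have mexpF : history_measurable (fun s h => (expR (F s h))%:E).
  by move=> *; apply/measurable_EFinP/measurableT_comp => //; exact: mF.
rewrite [leRHS]ge0_integral_noise_lawS; first last.
- by move=> e; rewrite lee_fin expR_ge0.
- exact: (mplay theta _ _ (fun s h => (expR (F s h))%:E) n.+1).
(* [c] is the cost once [b] has been played: its last term compensates exactly the loss in Jensen's
   inequality, leaving the cost of the past. *)
pose c := history_cost theta (zip a x) + theta 0 b ^+ 2 / 2.
have := @normal_prob_shift_jensen R (theta 0 b) (D + `|c|) (fun y => v y + c).
have -> : \int[gauss R 0]_y (v y + c) - theta 0 b ^+ 2 / 2 =
    \int[gauss R 0]_y v y + history_cost theta (zip a x).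
  rewrite RintegralD//.
  - by rewrite Rintegral_probability_cst /c addrA addrK.
  - exact: finite_measure_integrable_bounded vD.
  - exact: finite_measure_integrable_cst.
move=> jensen; apply: le_trans (jensen _ _) _ => //.
- exact: measurable_funD.
- by move=> y; rewrite (le_trans (ler_normD _ _))// lerD.
apply: ge0_le_integral => //.
- apply/measurable_EFinP/measurableT_comp => //; apply: measurable_funD => //.
  by apply: (measurableT_comp mv); exact: measurable_funD.
- apply: (measurable_fun_fubini_tonelli_F
      (fun z => (expR (F s (play theta s (zip a x) (tuple_cons z))))%:E)).
    exact: (measurableT_comp (mplay theta _ _ (fun s h => (expR (F s h))%:E)
      n.+1 k a x mexpF) (@measurable_tuple_cons R n)).
  by move=> z; rewrite lee_fin expR_ge0.
(* The cost ignores rewards, so [c] is the cost of the history extended by the reward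
   [theta 0 b + y], to which the induction hypothesis applies. *)
move=> y _; have -> : v (theta 0 b + y) + c = v (theta 0 b + y) +
    history_cost theta (zip a' (x' (theta 0 b + y))).
  by rewrite zipE history_cost_rcons.
by apply: le_trans (IHn _ a' (x' (theta 0 b + y))) _; rewrite zipE.
Qed.

End change_of_measure.

(** * Summing the errors over the possible best arms *)

Lemma Rintegral_sum d (T : measurableType d) (R : realType)
    (mu : {measure set T -> \bar R}) (I : Type) (r : seq I) (f : I -> T -> R) :
  (forall i, mu.-integrable setT (EFin \o f i)) ->
  \int[mu]_x (\sum_(i <- r) f i x) = \sum_(i <- r) \int[mu]_x f i x.
Proof.
move=> fi; elim: r => [|i r IHr].
  under eq_Rintegral do rewrite big_nil.
  by rewrite big_nil /Rintegral integral0.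
under eq_Rintegral do rewrite big_cons.
rewrite big_cons RintegralD// ?IHr// (_ : _ \o _ =
    fun x => (\sum_(j <- r) (f j x)%:E)%E).
  by apply: integrable_sum => // k _; exact: fi.
by apply/funext => x /=; rewrite sumEFin.
Qed.

(** [expR (- (1 / 5)) >= 4 / 5] gives [expR (1 / 5) <= 5 / 4]. This makes the exponential of an
    indicator linear in it. *)
Lemma expR_div5_le (R : realType) (b : bool) :
  expR (b%:R / 5) <= 1 + b%:R / 4 :> R.
Proof.
case: b; last by rewrite !mul0r expR0 addr0.
have : 4 / 5 * expR (1 / 5) <= 1 :> R.
  rewrite -[leRHS](expRxMexpNx_1 (1 / 5)) mulrC ler_pM2l ?expR_gt0//.
  by apply: le_trans (expR_ge1Dx _); lra.
rewrite mulr1n; lra.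
Qed.

Section single_best_arm.
Variables (R : realType) (M T : nat) (A : algorithm R M).

Lemma measurable_final (theta : 'rV[R]_M) d' (Y : measurableType d')
    (F : seed A -> history R M -> Y) :
  history_measurable F ->
  measurable_fun setT
    (fun x : run A T => F x.1 (play theta x.1 [::] x.2)).
Proof.
move=> mF.
have mpair : measurable_fun setT
    (fun x : run A T => ((x.1, [tuple] : 0.-tuple (measurableTypeR R)), x.2)).
  by apply: measurable_fun_pair => //; exact: measurable_fun_pair.
exact: (measurableT_comp (measurable_play theta mF [tuple] (m := T)) mpair).
Qed.

Definition wrong (j : 'I_M) (s : seed A) (h : history R M) : R :=
  (answer s h != j)%:R.

Lemma measurable_wrong j : history_measurable (wrong j).
Proof.
move=> n a.
have mneq : measurable_fun setT (fun k : nat => (k != j)%:R : R) by [].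
exact: (measurableT_comp mneq (@measurable_answer _ _ A n a)).
Qed.

Lemma normr_wrong j s h : `|wrong j s h| <= 1.
Proof. by rewrite /wrong; case: (_ != _); rewrite ?normr0 ?normr1. Qed.

Lemma measurable_estimate (theta : 'rV[R]_M) j :
  measurable [set x : run A T | estimate theta x = j].
Proof.
have mest : measurable_fun setT (fun x : run A T => estimate theta x : nat).
  exact: (measurable_final theta (F := fun s h => answer s h : nat)
    (@measurable_answer _ _ A)).
have := mest measurableT [set (j : nat)] => /(_ Logic.I).
rewrite setTI; congr measurable.
by apply/seteqP; split => x /= => [/val_inj|->].
Qed.

(** Integrating over the noise first reduces the lower bound to a fixed seed, that is, to a
    deterministic algorithm. *)
Lemma error_probE (theta : 'rV[R]_M) j :
  error_prob T A theta j =
  (\int[seed_law A]_s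
    (\int[noise_law R T]_e wrong j s (play theta s [::] e))%:E)%E.
Proof.
pose f (x : run A T) := (wrong j x.1 (play theta x.1 [::] x.2))%:E.
have mf : measurable_fun setT f.
  apply/measurable_EFinP.
  exact: (measurable_final theta (measurable_wrong j)).
have mE : measurable [set x : run A T | estimate theta x != j].
  rewrite (_ : mkset _ = ~` [set x : run A T | estimate theta x = j]).
    by apply: measurableC; exact: measurable_estimate.
  by apply/seteqP; split => x /= /eqP.
rewrite /error_prob -[in LHS](setIT (mkset _)) -integral_indic//.
transitivity (\int[run_law A T]_x f x)%E.
  apply: eq_integral => x _; congr EFin; rewrite indicE /wrong.
  by congr (nat_of_bool _)%:R; apply/idP/idP => [/set_mem//|h]; exact/mem_set.
rewrite fubini_tonelli1//; last by move=> x; rewrite lee_fin ler0n.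
apply: eq_integral => s _; rewrite /fubini_F /f/= fineK//.
apply: integrable_fin_num => //.
apply: (@finite_measure_integrable_bounded _ _ _ (noise_law R T)
  (fun e => wrong j s (play theta s [::] e)) 1) => // [|e];
  last exact: normr_wrong.
exact: (measurableT_comp (measurable_final theta (measurable_wrong j))
  (pair1_measurable s)).
Qed.

Section arms.
Variable Delta : R.

Definition best_arm (j : 'I_M) : 'rV[R]_M := Delta *: delta_mx 0 j.

Lemma instance_at_best_arm j : instance_at Delta j (best_arm j).
Proof.
split=> [|i ij]; rewrite !mxE eqxx /=; first by rewrite eqxx mulr1.
by rewrite (negPf ij) mulr0.
Qed.

Lemma sum_wrong s h : \sum_j wrong j s h = M%:R - 1.
Proof.
rewrite (bigD1 (answer s h))//= {1}/wrong eqxx add0r.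
under eq_bigr => j ja do rewrite /wrong eq_sym ja.
rewrite sumr_const cardC1 card_ord.
have M0 : (0 < M)%N by case: (answer s h) => k /(leq_trans _); exact.
by rewrite -[in RHS](prednK M0) -natr1 addrK.
Qed.

(** A round is charged only in the instance whose best arm it pulls, so the instances share one
    budget set by the number of rounds. *)
Lemma sum_history_cost h :
  \sum_j history_cost (best_arm j) h = (size h)%:R * (Delta ^+ 2 / 2).
Proof.
rewrite /history_cost exchange_big/=.
rewrite (eq_bigr (fun=> Delta ^+ 2 / 2)); last first.
  move=> r _; rewrite (bigD1 r.1)//= big1 ?addr0 => [|j jr].
    by rewrite !mxE !eqxx mulr1.
  by rewrite !mxE eqxx/= eq_sym (negPf jr) mulr0 expr0n/= mul0r.
by rewrite big_const_seq count_predT iter_addr_0 mulr_natl.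
Qed.

(** Four times the sum over [j] of the change of measure bounds; the summed integrand under the zero
    instance is constant in the noise. *)
Lemma seed_error_lower_bound s :
  4 * (M%:R - 1) / 5 - 2 * (Delta ^+ 2 * T%:R) <=
  \sum_j \int[noise_law R T]_e wrong j s (play (best_arm j) s [::] e).
Proof.
pose P := noise_law R T.
pose G j e := wrong j s (play 0 s [::] e) / 5 -
  history_cost (best_arm j) (play 0 s [::] e).
have mwrong theta j : measurable_fun setT
    (fun e : T.-tuple (measurableTypeR R) => wrong j s (play theta s [::] e)).
  exact: (measurableT_comp (measurable_final theta (measurable_wrong j))
    (pair1_measurable s)).
have iwrong theta j : P.-integrable setT
    (fun e => (wrong j s (play theta s [::] e))%:E).
  apply: (finite_measure_integrable_bounded _ (mwrong theta j)) => e.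
  exact: normr_wrong.
have FB j s' h : `|wrong j s' h / 5| <= 1.
  rewrite normrM (ger0_norm (_ : 0 <= 5^-1))//.
  by rewrite ler_pdivrMr// (le_trans (normr_wrong _ _ _))// mul1r ler1n.
have i1 j : P.-integrable setT
    (EFin \o (fun e => wrong j s (play 0 s [::] e) / 5)).
  apply: finite_measure_integrable_bounded (fun=> FB _ _ _).
  by apply: measurable_funM => //; exact: mwrong.
have i2 j : P.-integrable setT
    (EFin \o (fun e => history_cost (best_arm j) (play 0 s [::] e))).
  apply: (@finite_measure_integrable_bounded _ _ _ P _
      (T%:R * \sum_i best_arm j 0 i ^+ 2 / 2)).
    exact: (measurableT_comp (measurable_final 0 (@measurable_history_cost _ _
      (best_arm j) _ (seed A))) (pair1_measurable s)).
  move=> e; apply: le_trans (history_cost_bound _ _) _.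
  by rewrite size_play add0n (size_tuple e).
have iG j : P.-integrable setT (EFin \o G j).
  exact: (integrableB measurableT (i1 j) (i2 j)).
(* [change_of_measure] for [F = wrong / 5], linearised by [1 + x <= expR x] on
   the left and [expR_div5_le] on the right. *)
have step j : \int[P]_e G j e <=
    (\int[P]_e wrong j s (play (best_arm j) s [::] e)) / 4.
  have mF : history_measurable (fun s h => wrong j s h / 5).
    by move=> n a; apply: measurable_funM => //; exact: measurable_wrong.
  have i4 : P.-integrable setT
      (EFin \o (fun e => wrong j s (play (best_arm j) s [::] e) / 4)).
    exact: (integrableZr measurableT 4^-1 (iwrong (best_arm j) j)).
  have i14 : P.-integrable setT
      (EFin \o (fun e => 1 + wrong j s (play (best_arm j) s [::] e) / 4)).
    exact: (integrableD measurableT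
      (finite_measure_integrable_cst P 1 measurableT) i4).
  have := @change_of_measure R M A (best_arm j) _ 1 mF (FB j) T s 0
    [tuple] [tuple].
  rewrite [history_cost _ _]big_nil addr0 => cm.
  pose V := \int[P]_e G j e.
  pose W := \int[P]_e (1 + wrong j s (play (best_arm j) s [::] e) / 4).
  have : ((expR V)%:E <= W%:E)%E.
    apply: le_trans cm _.
    rewrite /W [in leRHS]/Rintegral fineK; last exact: integrable_fin_num i14.
    apply: ge0_le_integral => //.
    - apply/measurable_EFinP/measurableT_comp => //.
      by apply: measurable_funM => //; exact: mwrong.
    - exact: measurable_int i14.
    - by move=> e _; rewrite lee_fin; exact: expR_div5_le.
  rewrite lee_fin /W RintegralD//; last exact: finite_measure_integrable_cst.
  rewrite Rintegral_probability_cst RintegralZr//; last exact: iwrong.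
  by have := expR_ge1Dx V; rewrite /V; lra.
have sumG : \sum_j \int[P]_e G j e = (M%:R - 1) / 5 - T%:R * (Delta ^+ 2 / 2).
  rewrite -Rintegral_sum//.
  rewrite (@eq_Rintegral _ _ _ _ _
    (cst ((M%:R - 1) / 5 - T%:R * (Delta ^+ 2 / 2)))).
    by rewrite Rintegral_probability_cst.
  move=> e _; rewrite sumrB -mulr_suml sum_wrong sum_history_cost.
  by rewrite size_play add0n (size_tuple e).
have : \sum_j \int[P]_e G j e <=
    \sum_j (\int[P]_e wrong j s (play (best_arm j) s [::] e)) / 4.
  by apply: ler_sum => j _; exact: step.
rewrite sumG -mulr_suml; lra.
Qed.

Lemma sum_error_prob_lower_bound (c : R) : 0 <= c ->
  c <= 4 * (M%:R - 1) / 5 - 2 * (Delta ^+ 2 * T%:R) ->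
  (c%:E <= \sum_j error_prob T A (best_arm j) j)%E.
Proof.
move=> c0 cle.
under eq_bigr do rewrite error_probE.
have mp j : measurable_fun setT (fun s =>
    (\int[noise_law R T]_e wrong j s (play (best_arm j) s [::] e))%:E).
  apply/measurable_EFinP.
  apply: (@measurable_Rintegral_section R _ _ _ _ (seed_law A) (noise_law R T)
    (fun x => wrong j x.1 (play (best_arm j) x.1 [::] x.2)) 1).
    exact: measurable_final (measurable_wrong j).
  by move=> x; exact: normr_wrong.
rewrite -ge0_integral_sum//; last first.
  by move=> j s _; rewrite lee_fin Rintegral_ge0// => e _; exact: ler0n.
rewrite -[c%:E]mule1 -[X in (_ * X)%E](@probability_setT _ _ _ (seed_law A)).
rewrite -integral_cst//; apply: ge0_le_integral => //.
  exact: emeasurable_sum.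
move=> s _; rewrite sumEFin lee_fin.
exact: le_trans cle (seed_error_lower_bound s).
Qed.

End arms.
End single_best_arm.

(** * Choice of the constant and conclusion *)

Lemma exists_large_error (R : realType) (M T : nat) (Delta : R)
    (A : algorithm R M) : (1 < M)%N -> 0 < Delta ->
  T%:R < 60^-1 * (M%:R / Delta ^+ 2) ->
  exists j, ((3^-1)%:E < error_prob T A (best_arm Delta j) j)%E.
Proof.
move=> M1 D0 TM; apply: contrapT => /forallNP small.
have DT : Delta ^+ 2 * T%:R <= M%:R / 60.
  have D2 : 0 < Delta ^+ 2 by rewrite exprn_gt0.
  apply/ltW; rewrite mulrC -ltr_pdivlMr//; move: TM; congr (_ < _).
  by field; rewrite gt_eqF.
have M2 : 2 <= M%:R :> R by rewrite ler_nat.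
(* With [Delta ^+ 2 * T <= M / 60] the bound is at least [23 / 30 * M - 4 / 5], which is
   [11 / 30 * M] at [M = 2] and larger beyond. Errors all at most 1/3 would sum to at most
   [10 / 30 * M]. *)
have := @sum_error_prob_lower_bound R M T A Delta (11 / 30 * M%:R).
have /[swap] /[apply] : 0 <= 11 / 30 * M%:R :> R by rewrite mulr_ge0.
have /[swap] /[apply] : 11 / 30 * M%:R <=
  4 * (M%:R - 1) / 5 - 2 * (Delta ^+ 2 * T%:R) by lra.
apply/negP; rewrite -ltNge.
apply: (@le_lt_trans _ _ (\sum_(j < M) (3^-1)%:E)%E).
  by apply: lee_sum => j _; rewrite leNgt; apply/negP; exact: small.
by rewrite sumEFin sumr_const card_ord lte_fin -mulr_natr; lra.
Qed.

Theorem theorem4p8 (R : realType) :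
  (exists c : R, 0 < c /\
    forall (M T : nat) (Delta : R), (1 < M)%N -> 0 < Delta ->
      T%:R < c * (M%:R / Delta ^+ 2) ->
      ((3^-1 : R)%:E <= minimax_error M T Delta)%E) /\
  (exists c : R, 0 < c /\
    forall (M T : nat) (Delta : R), (1 < M)%N -> 0 < Delta ->
      forall A : algorithm R M,
      (forall (theta : 'rV[R]_M) (j : 'I_M), instance_at Delta j theta ->
         ((2 / 3 : R)%:E <= success_prob T A theta j)%E) ->
      c * (M%:R / Delta ^+ 2) <= T%:R).
Proof.
split; exists 60^-1; split; rewrite ?invr_gt0// => M T Delta M1 D0.
  move=> TM; apply: le_ereal_inf_tmp => _ [A ->].
  have [j /ltW errj] := exists_large_error A M1 D0 TM.
  apply: le_trans errj _; apply: ereal_sup_ubound.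
  by exists (best_arm Delta j), j; split => //; exact: instance_at_best_arm.
(* Success 2/3 everywhere allows an error of exactly 1/3, so the strict inequality of
   [exists_large_error] is needed here. *)
move=> A succ; rewrite leNgt; apply/negP => TM.
have [j] := exists_large_error A M1 D0 TM.
apply/negP; rewrite -leNgt /error_prob.
have := succ _ j (instance_at_best_arm Delta j).
rewrite /success_prob => succj.
rewrite (_ : [set x | _ != j] =
    ~` [set x : run A T | estimate (best_arm Delta j) x = j]); last first.
  by apply/seteqP; split => x /= /eqP.
rewrite probability_setC; last exact: measurable_estimate.
have mj := @measurable_estimate _ _ T A (best_arm Delta j) j.
move: succj; rewrite -(fineK (fin_num_measure (run_law A T) _ mj)).
by rewrite -EFinB !lee_fin; lra.
Qed.
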